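(* Let $Y_1$ and $Y_0$ be real random variables (potential outcomes under treatment and control) with fixed marginal cumulative distribution functions $F_1$ and $F_0$ respectively, let $\Delta=Y_1-Y_0$ be the individual treatment effect, and let $F_\Delta(\cdot)$ be the cumulative distribution function of $\Delta$. For any given value $\delta$, best-possible bounds $F^L(\delta)\le F_\Delta(\delta)\le F^U(\delta)$ on $F_\Delta(\delta)$ are given by $$F^L(\delta)=\sup_y\max\{F_1(y)-P(Y_0<y-\delta),0\}=\sup_y\max\{F_1(y)-F_0(y-\delta)+P(Y_0=y-\delta),0\},$$ $$F^U(\delta)=1+\inf_y\min\{F_1(y)-P(Y_0<y-\delta),0\}=1+\inf_y\min\{F_1(y)-F_0(y-\delta)+P(Y_0=y-\delta),0\}.$$
   Context: Cumulative distribution functions are right-continuous: $F_j(y)=P(Y_j\le y)$ for $j=0,1$ and $F_\Delta(\delta)=P(Y_1-Y_0\le\delta)$. The margins $F_1,F_0$ are fixed and the joint distribution of $(Y_1,Y_0)$ is unspecified. Suprema and infima are over $y\in\mathbb{R}$. ''Best-possible bounds'' means that the bounds are valid for every joint distribution of $(Y_1,Y_0)$ with margins $F_1,F_0$, and cannot be improved pointwise: for every $\delta\in\mathbb{R}$ and $\epsilon>0$ there is a joint distribution with these margins under which $F_\Delta(\delta)<F^L(\delta)+\epsilon$, and there is a joint distribution with these margins under which $F_\Delta(\delta)>F^U(\delta)-\epsilon$. *)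

(* Defs.v *)
From HB Require Import structures.
From mathcomp Require Export all_boot all_order all_algebra.
From mathcomp Require Export all_classical all_reals all_analysis.
From mathcomp Require Export measurable_realfun.

Set Implicit Arguments.
Unset Strict Implicit.
Unset Printing Implicit Defensive.

Import Order.TTheory GRing.Theory Num.Theory.
Import numFieldNormedType.Exports.

Local Open Scope classical_set_scope.
Local Open Scope ring_scope.
Local Open Scope ereal_scope.

Definition has_margins (R : realType) (F1 F0 : R -> \bar R)
    (d : measure_display) (T : measurableType d) (P : probability T R)
    (Y1 Y0 : {RV P >-> R}) : Prop :=
  (forall y, cdf Y1 y = F1 y) /\ (forall y, cdf Y0 y = F0 y).

(* A joint distribution is represented by a pair of random variables on an
   arbitrary probability space, which is allowed to vary. *)
Definition best_possible_bounds (R : realType) (F1 F0 : R -> \bar R)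
    (FL FU : R -> \bar R) : Prop :=
  [/\ forall (d : measure_display) (T : measurableType d) (P : probability T R)
             (Y1 Y0 : {RV P >-> R}), has_margins F1 F0 Y1 Y0 ->
        forall delta : R,
          FL delta <= cdf (Y1 \- Y0 : {RV P >-> R})%R delta <= FU delta,
      forall (delta eps : R), (0 < eps)%R ->
        exists (d : measure_display) (T : measurableType d)
               (P : probability T R) (Y1 Y0 : {RV P >-> R}),
          has_margins F1 F0 Y1 Y0 /\
          cdf (Y1 \- Y0 : {RV P >-> R})%R delta < FL delta + eps%:E
    & forall (delta eps : R), (0 < eps)%R ->
        exists (d : measure_display) (T : measurableType d)
               (P : probability T R) (Y1 Y0 : {RV P >-> R}),
          has_margins F1 F0 Y1 Y0 /\
          FU delta - eps%:E < cdf (Y1 \- Y0 : {RV P >-> R})%R delta].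

Definition lower_bound_lt (R : realType) (F1 : R -> \bar R)
    (d : measure_display) (T : measurableType d) (P : probability T R)
    (Y0 : {RV P >-> R}) (delta : R) : \bar R :=
  ereal_sup (range (fun y : R =>
    maxe (F1 y - P [set t | (Y0 t < y - delta)%R]) 0)).

Definition lower_bound_atom (R : realType) (F1 F0 : R -> \bar R)
    (d : measure_display) (T : measurableType d) (P : probability T R)
    (Y0 : {RV P >-> R}) (delta : R) : \bar R :=
  ereal_sup (range (fun y : R =>
    maxe (F1 y - F0 (y - delta)%R + P [set t | Y0 t = (y - delta)%R]) 0)).

Definition upper_bound_lt (R : realType) (F1 : R -> \bar R)
    (d : measure_display) (T : measurableType d) (P : probability T R)
    (Y0 : {RV P >-> R}) (delta : R) : \bar R :=
  1 + ereal_inf (range (fun y : R =>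
    mine (F1 y - P [set t | (Y0 t < y - delta)%R]) 0)).

Definition upper_bound_atom (R : realType) (F1 F0 : R -> \bar R)
    (d : measure_display) (T : measurableType d) (P : probability T R)
    (Y0 : {RV P >-> R}) (delta : R) : \bar R :=
  1 + ereal_inf (range (fun y : R =>
    mine (F1 y - F0 (y - delta)%R + P [set t | Y0 t = (y - delta)%R]) 0)).

(* Main.v *)
From HB Require Import structures.
From mathcomp Require Import lra.
Require Import Defs.
Set Implicit Arguments.
Unset Strict Implicit.
Unset Printing Implicit Defensive.

Import Order.TTheory GRing.Theory Num.Theory.
Import numFieldNormedType.Exports.

Local Open Scope classical_set_scope.
Local Open Scope ring_scope.

(** Validity of the bounds is a union bound: for every [y], the event
[Y1 <= y] is covered by [Y1 - Y0 <= delta] and [Y0 < y - delta], and the event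
[Y0 < y - delta] is covered by [Y1 <= y] and [Y1 - Y0 > delta]
([cdf_sub_ge] and [cdf_sub_le]).

Sharpness rests on one coupling.  Take [U] uniform on [0, 1], couple [U] with
its rotation by [s] modulo 1, which is again uniform ([cdf_rotation]), and feed
the two into the quantile functions of the prescribed margins
([cdf_quantile_uniform]).  Except on an event of probability at most [s], the
two coordinates are then the [u]-quantile of the one margin and the
[(u - s)]-quantile of the other ([shifted_quantile_coupling]).

For the lower bound [L], rotate [Y0] by [s = L + eps / 2].  If [A - B <= delta]
held at a level [u > s], put [y := A]; then [u <= F1 y], because [A] is a
[u]-quantile, and [P (Y0 < y - delta) <= u - s], because [B >= y - delta] is a
[(u - s)]-quantile.  Hence [F1 y - P (Y0 < y - delta) >= s > L], which
contradicts the definition of [L].  So [A - B <= delta] has probability at most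
[s].

For the upper bound [1 + J], rotate [Y1] by [s = - J].  If [A - B > delta] held
at a level [u > s], any [y] strictly between [B + delta] and [A] would satisfy
[F1 y < u - s] and [P (Y0 < y - delta) >= u], so that
[F1 y - P (Y0 < y - delta) < J], again a contradiction.

When the required shift is at least 1 the wanted inequality is weaker than
[0 <= cdf <= 1], and the given pair [(Y1, Y0)] itself is a witness. *)

(** * Events defined by a random variable *)

Lemma cdfE (R : realType) (d : measure_display) (T : measurableType d)
    (P : probability T R) (X : {RV P >-> R}) (y : R) :
  cdf X y = P [set t | X t <= y].
Proof.
by congr (P _); apply/seteqP; split=> t /=; rewrite in_itv.
Qed.

Lemma measurable_RV_le (R : realType) (d : measure_display)
    (T : measurableType d) (P : probability T R) (X : {RV P >-> R}) (y : R) :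
  measurable [set t | X t <= y].
Proof.
rewrite (_ : [set t | _] = X @^-1` `]-oo, y]); first exact: measurable_funPTI.
by apply/seteqP; split => t /=; rewrite in_itv.
Qed.

Lemma measurable_RV_lt (R : realType) (d : measure_display)
    (T : measurableType d) (P : probability T R) (X : {RV P >-> R}) (y : R) :
  measurable [set t | X t < y].
Proof.
rewrite (_ : [set t | _] = X @^-1` `]-oo, y[); first exact: measurable_funPTI.
by apply/seteqP; split => t /=; rewrite in_itv.
Qed.

(** Continuity from below, along the events [X <= z - (n + 1)^-1]. *)
Lemma probability_lt_le (R : realType) (d : measure_display)
    (T : measurableType d) (P : probability T R) (X : {RV P >-> R}) (z : R)
    (c : \bar R) :
  (forall y, y < z -> (cdf X y <= c)%E) -> (P [set t | (X t < z)%R] <= c)%E.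
Proof.
move=> Xc; pose A n := [set t | X t <= z - n.+1%:R^-1].
have -> : [set t | X t < z] = \bigcup_n A n.
  apply/seteqP; split=> [t /= Xz|t [n _] /= /le_lt_trans]; last first.
    by apply; rewrite ltrBlDr ltrDl invr_gt0.
  have [n nX] := ltr_add_invr Xz.
  by exists n => //=; rewrite /A/= lerBrDr ltW.
have AP : (P \o A) n @[n --> \oo] --> P (\bigcup_n A n).
  apply: nondecreasing_cvg_mu => [n||n m nm].
  - exact: measurable_RV_le.
  - by apply: bigcupT_measurable => n; exact: measurable_RV_le.
  - apply/subsetPset => t /=; rewrite /A/= => /le_trans; apply.
    by rewrite lerB// lef_pV2 ?posrE// ler_nat.
apply: (cvge_le _ AP); apply: nearW => n /=.
by rewrite -cdfE Xc// ltrBlDr ltrDl invr_gt0.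
Qed.

Lemma eq_cdf_probability_lt (R : realType) (d d' : measure_display)
    (T : measurableType d) (P : probability T R) (X : {RV P >-> R})
    (T' : measurableType d') (P' : probability T' R) (X' : {RV P' >-> R}) :
  cdf X = cdf X' ->
  forall z, P [set t | X t < z] = P' [set t | X' t < z].
Proof.
have le_cdf d1 d2 (T1 : measurableType d1) (P1 : probability T1 R)
    (X1 : {RV P1 >-> R}) (T2 : measurableType d2) (P2 : probability T2 R)
    (X2 : {RV P2 >-> R}) z : cdf X1 = cdf X2 ->
    (P1 [set t | (X1 t < z)%R] <= P2 [set t | (X2 t < z)%R])%E.
  move=> X12; apply: probability_lt_le => y yz; rewrite X12 cdfE.
  apply: le_measure; rewrite ?inE.
  - exact: measurable_RV_le.
  - exact: measurable_RV_lt.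
  - by move=> t /= /le_lt_trans; apply.
by move=> XX' z; apply/le_anti/andP; split; exact: le_cdf.
Qed.

(** * Quantile functions *)

(** The value 0 outside of ]0, 1[ is a convention: there the infimum may be
taken over an empty or an unbounded set. *)
Definition quantile (R : realType) (d : measure_display)
    (T : measurableType d) (P : probability T R) (X : {RV P >-> R})
    (u : R) : R :=
  if 0 < u < 1 then inf [set y | (u%:E <= cdf X y)%E] else 0.

(** The Galois connection between [quantile X] and [cdf X].  The limits of the
cdf at both infinities make the infimum finite, and right-continuity makes it a
minimum. *)
Lemma quantile_le (R : realType) (d : measure_display)
    (T : measurableType d) (P : probability T R) (X : {RV P >-> R}) (u y : R) :
  0 < u < 1 -> (quantile X u <= y) = (u%:E <= cdf X y)%E.
Proof.
move=> u01; rewrite /quantile u01; case/andP: u01 => u0 u1.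
set S := [set y | _].
have [z zu] : exists z, (cdf X z < u%:E)%E.
  suff : nbhs (0%E : \bar R) [set x | (x < u%:E)%E].
    by move=> /(cvg_cdfNy0 X) cdfu; exact: (@filter_ex _ -oo%R _ _ cdfu).
  apply: open_nbhs_nbhs; split; first exact: open_ereal_lt_ereal.
  by rewrite /= lte_fin.
have [w uw] : exists w, (u%:E < cdf X w)%E.
  suff : nbhs (1%E : \bar R) [set x | (u%:E < x)%E].
    by move=> /(cvg_cdfy1 X) cdfu; exact: (@filter_ex _ +oo%R _ _ cdfu).
  apply: open_nbhs_nbhs; split; first exact: open_ereal_gt_ereal.
  by rewrite /= lte_fin.
have Slb : has_lbound S.
  exists z => x; rewrite /S/= => ux; rewrite leNgt; apply/negP => /ltW xz.
  have := le_lt_trans (le_trans ux (cdf_nondecreasing X xz)) zu.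
  by rewrite ltxx.
apply/idP/idP => [Sy|uy]; last exact: ge_inf.
apply: (cvge_ge _ (@cdf_right_continuous _ _ _ _ X y)).
near=> x.
have [x' Sx' /ltW x'x] : exists2 x', S x' & x' < x.
  by apply: inf_lt; [exists w; exact: ltW|apply: le_lt_trans Sy _].
exact: le_trans Sx' (cdf_nondecreasing X x'x).
Unshelve. all: by end_near. Qed.

Lemma measurable_quantile (R : realType) (d : measure_display)
    (T : measurableType d) (P : probability T R) (X : {RV P >-> R}) :
  measurable_fun setT (quantile X).
Proof.
apply: measurable_fun_if => //.
- by apply: measurable_and; exact: measurable_fun_ltr.
- rewrite setTI (_ : _ @^-1` _ = `]0, 1[%classic); last first.
    by apply/seteqP; split=> u /=; rewrite in_itv.
  apply: (measurability (@RGenOInfty.G R)); first exact: RGenOInfty.measurableE.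
  move=> _ [_ [y ->] <-].
  rewrite (_ : _ `&` _ = `]0, 1[%classic `&` `]fine (cdf X y), +oo[%classic).
    exact: measurableI.
  have yq u : 0 < u < 1 ->
      (y < inf [set z | (u%:E <= cdf X z)%E]) = (fine (cdf X y) < u).
    move=> u01; have := quantile_le X y u01; rewrite /quantile u01 !ltNge => ->.
    by rewrite -lee_fin fineK ?fin_num_measure.
  by apply/seteqP; split=> u /= []; rewrite !in_itv/= !andbT => u01;
    rewrite yq.
Qed.

HB.instance Definition _ (R : realType) (d : measure_display)
    (T : measurableType d) (P : probability T R) (X : {RV P >-> R}) :=
  isMeasurableFun.Build _ _ _ _ (quantile X) (measurable_quantile X).

(** The quantile transform.  By the Galois connection, [quantile X V <= y] and
[V <= cdf X y] are the same event as long as [V] lies in ]0, 1[, which a uniform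
variable does almost surely. *)
Lemma cdf_quantile_uniform (R : realType) (d d' : measure_display)
    (T : measurableType d) (P : probability T R) (X : {RV P >-> R})
    (T' : measurableType d') (Q : probability T' R) (V : {RV Q >-> R}) (y : R) :
  (forall t, 0 <= t <= 1 -> cdf V t = t%:E) ->
  cdf (quantile X \o V : {RV Q >-> R}) y = cdf X y.
Proof.
move=> VU.
have V0 : Q [set t | V t <= 0] = 0%E by rewrite -cdfE VU ?lexx ?ler01.
have V1 : Q (~` [set t | V t < 1]) = 0%E.
  rewrite probability_setC; last exact: measurable_RV_lt.
  suff -> : Q [set t | V t < 1] = 1%E by rewrite subee.
  apply/eqP; rewrite eq_le probability_le1 ?andTb; last exact: measurable_RV_lt.
  apply/lee_subgt0Pr => e e0.
  have [e1|e1] := leP e 1.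
    rewrite -EFinB -VU; last by rewrite subr_ge0 e1 lerBlDr lerDl ltW.
    rewrite cdfE; apply: le_measure; rewrite ?inE//.
    - exact: measurable_RV_le.
    - exact: measurable_RV_lt.
    - by move=> t /= /le_lt_trans; apply; rewrite ltrBlDr ltrDl.
  by rewrite (le_trans _ (measure_ge0 _ _))// -EFinB lee_fin subr_le0 ltW.
have Xfin : (fine (cdf X y))%:E = cdf X y by rewrite fineK// fin_num_measure.
have f01 : 0 <= fine (cdf X y) <= 1.
  by rewrite -!lee_fin Xfin cdf_ge0 cdf_le1.
rewrite -Xfin -(VU _ f01) !cdfE.
set N := [set t | V t <= 0] `|` ~` [set t | V t < 1].
have mN : measurable N.
  apply: measurableU; first exact: measurable_RV_le.
  by apply: measurableC; exact: measurable_RV_lt.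
have N0 : Q N = 0%E.
  apply/eqP; rewrite eq_le measure_ge0 andbT.
  have := measureU2 Q (measurable_RV_le V 0)
    (measurableC (measurable_RV_lt V 1)).
  by move=> /le_trans; apply; rewrite /= V0 V1 adde0.
have NP t : ~ N t -> 0 < V t < 1.
  move=> /not_orP[/negP + /contrapT ->]; by rewrite -ltNge => ->.
have sub A B : measurable A -> measurable B -> A `<=` B `|` N -> (Q A <= Q B)%E.
  move=> mA mB AB; rewrite -[leRHS]adde0 -N0 (le_trans _ (measureU2 _ mB mN))//.
  by apply: le_measure; rewrite ?inE//; exact: measurableU.
have mle := measurable_RV_le.
apply/eqP; rewrite eq_le; apply/andP.
by split; apply: sub; try exact: mle; move=> t /=;
  (have [|/NP V01] := pselect (N t); first by right);
  rewrite quantile_le// -Xfin lee_fin; left.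
Qed.

(** * Rotations of the unit interval *)

(** The map [u - s] modulo 1, with representatives chosen in ]0, 1] rather than
[0, 1[, so that the rotation by 0 is the identity of ]0, 1]. *)
Definition rotation (R : realType) (s : R) (u : measurableTypeR R) : R :=
  if s < u then u - s else u - s + 1.

Lemma measurable_rotation (R : realType) (s : R) :
  measurable_fun setT (rotation s).
Proof.
apply: measurable_fun_if => //.
- exact: measurable_fun_ltr.
- by apply: measurable_funB => //; exact: measurable_id.
- apply: measurable_funD => //.
  by apply: measurable_funB => //; exact: measurable_id.
Qed.

HB.instance Definition _ (R : realType) (s : R) :=
  isMeasurableFun.Build _ _ _ _ (rotation s) (measurable_rotation s).

Definition uniform01 (R : realType) : probability (measurableTypeR R) R :=
  uniform_prob (@ltr01 R).

Lemma uniform01E (R : realType) (A : set (measurableTypeR R)) :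
  measurable A -> uniform01 R A = lebesgue_measure (A `&` `[0, 1]).
Proof.
move=> mA.
transitivity (\int[lebesgue_measure]_(x in A) (uniform_pdf 0 1 x)%:E)%E => //.
rewrite integral_uniform_pdf.
rewrite (eq_integral (fun=> 1%:E)); last first.
  move=> x; rewrite inE/= in_itv/= /uniform_pdf => -[_ ->].
  by rewrite subr0 invr1.
by rewrite integral_cst ?mul1e//; exact: measurableI.
Qed.

(** In [0, 1], the rotation is at most [t] on ]s, s + t] if [s + t < 1], and
otherwise on ]s, 1] together with the wrapped part [0, t + s - 1]. *)
Lemma cdf_rotation (R : realType) (s t : R) : 0 <= s < 1 -> 0 <= t <= 1 ->
  cdf (rotation s : {RV uniform01 R >-> R}) t = t%:E.
Proof.
move=> /andP[s0 s1] /andP[t0 t1].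
rewrite cdfE uniform01E; last first.
  exact: (measurable_RV_le (rotation s : {RV uniform01 R >-> R})).
have [st|st] := ltP (s + t) 1.
  transitivity (lebesgue_measure `]s, s + t]%classic).
    congr (lebesgue_measure _); apply/seteqP.
    split=> u /=; rewrite !in_itv/= /rotation.
      by case: ltP; lra.
    by move=> /andP[su ?]; rewrite su; lra.
  rewrite lebesgue_measure_itv/= lte_fin ltrDl.
  case: ltP => [_|t0']; first by rewrite -EFinB addrAC subrr add0r.
  by congr (_%:E); apply: le_anti; rewrite t0 t0'.
transitivity (lebesgue_measure (`[0, t + s - 1]%classic `|` `]s, 1]%classic)).
  congr (lebesgue_measure _); apply/seteqP.
  split=> u /=; rewrite !in_itv/= /rotation.
    by case: ltP => us; [right|left]; lra.
  by case: ltP => us [] ?; lra.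
transitivity (lebesgue_measure `[0%R, (t + s - 1)%R] +
              lebesgue_measure `]s, 1%R])%E.
  apply: measureU => //; apply/seteqP; split=> // u [/=].
  by rewrite !in_itv/=; lra.
rewrite !lebesgue_measure_itv/= !lte_fin s1.
by case: ltP => ts; rewrite -?EFinB ?add0e -?EFinD; congr (_%:E); lra.
Qed.

(** A coupling of two given margins in which, outside of an event [C] of
probability at most [s], the second variable lags behind the first by [s] in
quantile level.  The quantiles appear only through their Galois connection with
the cdfs, which is what the sharpness arguments consume. *)
Lemma shifted_quantile_coupling (R : realType) (d d' : measure_display)
    (T : measurableType d) (P : probability T R) (X : {RV P >-> R})
    (T' : measurableType d') (P' : probability T' R) (X' : {RV P' >-> R})
    (s : R) : 0 <= s < 1 ->
  exists (Q : probability (measurableTypeR R) R) (A B : {RV Q >-> R})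
         (C : set (measurableTypeR R)),
    [/\ (forall y, cdf A y = cdf X y) /\ (forall y, cdf B y = cdf X' y),
        measurable C, (Q C <= s%:E)%E &
        forall w, ~ C w -> exists u, [/\ s < u < 1,
          forall y, (A w <= y) = (u%:E <= cdf X y)%E &
          forall y, (B w <= y) = ((u - s)%:E <= cdf X' y)%E]].
Proof.
move=> s01; have /andP[s0 s1] := s01.
exists (uniform01 R), (quantile X \o rotation 0).
exists (quantile X' \o rotation s).
have mI : measurable (`]s, 1[%classic : set (measurableTypeR R)) by [].
exists (~` `]s, 1[); split.
- split=> y; apply: cdf_quantile_uniform => t t01; apply: cdf_rotation => //.
  by rewrite lexx ltr01.
- exact: measurableC.
- have mC : measurable (~` `]s, 1[%classic : set (measurableTypeR R)).
    exact: measurableC.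
  (* [C] is the complement of ]s, 1[, so it also contains the null endpoint 1. *)
  apply: (@le_trans _ _ (lebesgue_measure (`[0, s]%classic `|` [set 1]))).
    rewrite uniform01E//; apply: le_measure; rewrite ?inE.
    + exact: measurableI.
    + exact: measurableU.
    + move=> u /= [/negP]; rewrite !in_itv/= negb_and -!leNgt => us u01.
      have [->|/eqP u1] := eqVneq u 1; [by right|left; lra].
  apply: le_trans (measureU2 _ _ _) _ => //.
  rewrite /= lebesgue_measure_set1 adde0 lebesgue_measure_itv/= lte_fin.
  by case: ifP => _; rewrite lee_fin// subr0.
- move=> w /contrapT/=; rewrite in_itv/= => /andP[sw w1].
  exists w; split; first by rewrite sw.
    move=> y; rewrite /= {1}/rotation (le_lt_trans s0 sw) subr0.
    by rewrite quantile_le// w1 (le_lt_trans s0 sw).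
  by move=> y; rewrite /= /rotation sw quantile_le//; lra.
Qed.

(** * Validity and sharpness of the bounds *)

Section makarov.
Context (R : realType) (d : measure_display) (T : measurableType d)
  (P : probability T R) (Y1 Y0 : {RV P >-> R}).

Local Notation F1 := (cdf Y1).

Lemma cdf_lt_atom (z : R) :
  cdf Y0 z = (P [set t | (Y0 t < z)%R] + P [set t | Y0 t = z])%E.
Proof.
rewrite cdfE -measureU//.
- congr (P _); apply/seteqP; split => t /=; rewrite le_eqVlt.
    by move=> /orP[/eqP|]; [right|left].
  by move=> [->|->]; rewrite ?eqxx ?orbT.
- exact: measurable_RV_lt.
- by rewrite (_ : [set t | _] = Y0 @^-1` [set z])//; exact: measurable_funPTI.
- by apply/seteqP; split => t //= [] /[swap] ->; rewrite ltxx.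
Qed.

Lemma sub_lt_atom (a : \bar R) (z : R) : a \is a fin_num ->
  (a - P [set t | (Y0 t < z)%R] = a - cdf Y0 z + P [set t | Y0 t = z])%E.
Proof.
move=> afin.
have mE : measurable [set t | Y0 t = z].
  by rewrite (_ : [set t | _] = Y0 @^-1` [set z])//; exact: measurable_funPTI.
rewrite cdf_lt_atom.
have /fineK <- := fin_num_measure P _ mE.
have /fineK <- := fin_num_measure P _ (measurable_RV_lt Y0 z).
have /fineK <- := afin.
by rewrite -!EFinD; congr (_%:E); lra.
Qed.

Lemma cdf_sub_ge (delta y : R) :
  (F1 y - P [set t | (Y0 t < y - delta)%R] <=
   cdf (Y1 \- Y0 : {RV P >-> R})%R delta)%E.
Proof.
rewrite leeBlDr ?fin_num_measure//; last exact: measurable_RV_lt.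
rewrite !cdfE.
have mD := measurable_RV_le (Y1 \- Y0 : {RV P >-> R}) delta.
have mq := measurable_RV_lt Y0 (y - delta).
apply: le_trans (measureU2 _ mD mq).
apply: le_measure; rewrite ?inE//.
- exact: measurable_RV_le.
- exact: measurableU.
move=> t /= Yy; have [|] := ltP (Y0 t) (y - delta); first by right.
by left; lra.
Qed.

Lemma cdf_sub_le (delta y : R) :
  (cdf (Y1 \- Y0 : {RV P >-> R})%R delta <=
   1 + (F1 y - P [set t | (Y0 t < y - delta)%R]))%E.
Proof.
have mq := measurable_RV_lt Y0 (y - delta).
have mD := measurable_RV_le (Y1 \- Y0 : {RV P >-> R}) delta.
have : (P [set t | (Y0 t < y - delta)%R] <=
        F1 y + (1 - cdf (Y1 \- Y0 : {RV P >-> R})%R delta))%E.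
  rewrite !cdfE -probability_setC//.
  apply: le_trans (measureU2 _ (measurable_RV_le _ _) (measurableC mD)).
  apply: le_measure; rewrite ?inE//.
    by apply: measurableU; [exact: measurable_RV_le|exact: measurableC].
  move=> t /= Yy; have [|] := leP (Y1 t) y; first by left.
  by right; apply/negP; rewrite -ltNge; lra.
rewrite -(fineK (fin_num_measure P _ mq)).
have /fineK <- : cdf (Y1 \- Y0 : {RV P >-> R}) delta \is a fin_num.
  by rewrite fin_num_measure.
have /fineK <- : F1 y \is a fin_num by rewrite fin_num_measure.
by rewrite -!EFinD !lee_fin; lra.
Qed.

Lemma lower_bound_le_cdf (delta : R) :
  (lower_bound_lt F1 Y0 delta <= cdf (Y1 \- Y0 : {RV P >-> R})%R delta)%E.
Proof.
apply: ge_ereal_sup => _ [y _ <-].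
by rewrite ge_max cdf_sub_ge cdf_ge0.
Qed.

Lemma cdf_le_upper_bound (delta : R) :
  (cdf (Y1 \- Y0 : {RV P >-> R})%R delta <= upper_bound_lt F1 Y0 delta)%E.
Proof.
rewrite /upper_bound_lt -leeBlDl//; apply: le_ereal_inf_tmp => _ [y _ <-].
rewrite le_min !leeBlDl// cdf_sub_le adde0 /=.
exact: cdf_le1.
Qed.

(** The slack [eps / 2] in the shift cannot be dropped: if both margins are
uniform on [0, 1] and [delta = 0], the bound 0 is approached by small rotations,
but no coupling has [A > B] almost surely, since [A] and [B] have the same
mean. *)
Lemma lower_bound_sharp (delta eps : R) : 0 < eps ->
  exists (d' : measure_display) (T' : measurableType d')
         (Q : probability T' R) (A B : {RV Q >-> R}),
    has_margins F1 (cdf Y0) A B /\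
    (cdf (A \- B : {RV Q >-> R})%R delta <
     lower_bound_lt F1 Y0 delta + eps%:E)%E.
Proof.
move=> eps0.
set L := lower_bound_lt F1 Y0 delta.
have L0 : (0 <= L)%E.
  apply: le_trans (ereal_sup_ubound (imageP _ (I : setT (0 : R)))).
  by rewrite le_max lexx orbT.
have Lfin : L \is a fin_num.
  rewrite ge0_fin_numE//; apply: le_lt_trans (lower_bound_le_cdf delta) _.
  exact: le_lt_trans (cdf_le1 _ _) (ltry 1).
have := L0; rewrite -(fineK Lfin) lee_fin => l0.
set s := fine L + eps / 2.
have [s1|s1] := ltP s 1; last first.
  exists d, T, P, Y1, Y0; split=> //.
  apply: le_lt_trans (cdf_le1 _ _) _.
  by rewrite -EFinD lte_fin; move: s1; rewrite /s; lra.
have s01 : 0 <= s < 1 by rewrite s1 andbT /s; lra.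
have [Q [A [B [C [[AY BY] mC QC H]]]]] := shifted_quantile_coupling Y1 Y0 s01.
exists _, _, Q, A, B; split=> //.
apply: (@le_lt_trans _ _ s%:E); last by rewrite -EFinD lte_fin /s; lra.
apply: le_trans QC; rewrite cdfE.
apply: le_measure; rewrite ?inE//.
  exact: (measurable_RV_le (A \- B : {RV Q >-> R})).
move=> w /= ABw; apply: contrapT => /H[u [_ uA uB]].
have uF : (u%:E <= F1 (A w))%E by rewrite -uA.
(* The quantile relation bounds the cdf at each [y < A w - delta]; the strict
   event is the limit of these. *)
have Fu : (P [set t | (Y0 t < A w - delta)%R] <= (u - s)%:E)%E.
  apply: probability_lt_le => y yA.
  by rewrite leNgt; apply/negP => /ltW; rewrite -uB; lra.
have : (L < F1 (A w) - P [set t | (Y0 t < A w - delta)%R])%E.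
  apply: (@lt_le_trans _ _ (u - (u - s))%:E); last by rewrite EFinB leeB.
  by rewrite -(fineK Lfin) lte_fin /s; lra.
apply/negP; rewrite -leNgt.
apply: le_trans (ereal_sup_ubound (imageP _ (I : setT (A w)))).
by rewrite le_max lexx.
Qed.

(** The shift is [s = - J] without any slack: [A - B > delta] is strict, which
leaves room for a [y] strictly between [B + delta] and [A].  So the coupling
even attains the bound [1 + J]. *)
Lemma upper_bound_sharp (delta eps : R) : 0 < eps ->
  exists (d' : measure_display) (T' : measurableType d')
         (Q : probability T' R) (A B : {RV Q >-> R}),
    has_margins F1 (cdf Y0) A B /\
    (upper_bound_lt F1 Y0 delta - eps%:E <
     cdf (A \- B : {RV Q >-> R})%R delta)%E.
Proof.
move=> eps0; rewrite /upper_bound_lt; set J := ereal_inf _.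
have J0 : (J <= 0)%E.
  apply: le_trans (ereal_inf_lbound (imageP _ (I : setT (0 : R)))) _.
  by rewrite ge_min lexx orbT.
have J1 : (-1 <= J)%E.
  have := cdf_le_upper_bound delta; rewrite /upper_bound_lt -/J -leeBlDl//.
  apply: le_trans.
  by rewrite -[leLHS]add0e; apply: leeB => //; exact: cdf_ge0.
have Jfin : J \is a fin_num by rewrite fin_numE; case: (J) J0 J1.
move: J0 J1; rewrite -(fineK Jfin) !lee_fin; set s := - fine J => j0 j1.
have [s1|s1] := ltP s 1; last first.
  exists d, T, P, Y1, Y0; split=> //.
  apply: lt_le_trans (cdf_ge0 _ _).
  by rewrite -!EFinD lte_fin; move: s1; rewrite /s; lra.
have s01 : 0 <= s < 1 by rewrite s1 andbT /s; lra.
have [Q [B [A [C [[BY AY] mC QC H]]]]] := shifted_quantile_coupling Y0 Y1 s01.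
exists _, _, Q, A, B; split=> //.
apply: (@lt_le_trans _ _ (1 - Q C)%E).
  rewrite -(fineK (fin_num_measure Q _ mC)) in QC *.
  by move: QC; rewrite lee_fin -!EFinD lte_fin /s; lra.
rewrite -probability_setC// cdfE.
apply: le_measure; rewrite ?inE//; first exact: measurableC.
  exact: (measurable_RV_le (A \- B : {RV Q >-> R})).
move=> w /H[u [_ uB uA]] /=; rewrite leNgt; apply/negP => ABw.
set y := (B w + delta + A w) / 2.
have Fy : (F1 y < (u - s)%:E)%E by rewrite ltNge -uA -ltNge /y; lra.
have uF : (u%:E <= P [set t | (Y0 t < y - delta)%R])%E.
  have : (u%:E <= cdf Y0 (B w))%E by rewrite -uB.
  move=> /le_trans; apply; rewrite cdfE; apply: le_measure; rewrite ?inE.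
  - exact: measurable_RV_le.
  - exact: measurable_RV_lt.
  - by move=> t /= tB; rewrite /y; lra.
have : (F1 y - P [set t | (Y0 t < y - delta)%R] < J)%E.
  rewrite -(fineK Jfin) (_ : fine J = (u - s) - u); last by rewrite /s; lra.
  by rewrite EFinB; apply: lte_leB.
apply/negP; rewrite -leNgt.
apply: le_trans (ereal_inf_lbound (imageP _ (I : setT y))) _.
by rewrite ge_min lexx.
Qed.

End makarov.

Theorem theorem29 (R : realType) (F1 F0 : R -> \bar R)
    (d : measure_display) (T : measurableType d) (P : probability T R)
    (Y1 Y0 : {RV P >-> R}) (hY : has_margins F1 F0 Y1 Y0) :
  [/\ forall delta : R,
        lower_bound_lt F1 Y0 delta = lower_bound_atom F1 F0 Y0 delta,
      forall delta : R,
        upper_bound_lt F1 Y0 delta = upper_bound_atom F1 F0 Y0 delta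
    & best_possible_bounds F1 F0 (lower_bound_lt F1 Y0) (upper_bound_lt F1 Y0)].
Proof.
have [/funext <- /funext <-] := hY.
split.
- move=> delta; congr ereal_sup; apply: eq_imagel => y _ /=.
  by rewrite sub_lt_atom// fin_num_measure.
- move=> delta; congr (1 + ereal_inf _)%E; apply: eq_imagel => y _ /=.
  by rewrite sub_lt_atom// fin_num_measure.
- split; [|exact: lower_bound_sharp|exact: upper_bound_sharp].
  move=> d' T' Q A B [/funext AY /funext BY] delta.
  have BY0 := eq_cdf_probability_lt BY.
  apply/andP; split.
  + apply: le_trans (lower_bound_le_cdf A B delta); rewrite AY.
    rewrite (_ : lower_bound_lt _ B delta = lower_bound_lt (cdf Y1) Y0 delta)//.
    by congr ereal_sup; apply: eq_imagel => y _ /=; rewrite BY0.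
  + apply: le_trans (cdf_le_upper_bound A B delta) _; rewrite AY.
    rewrite (_ : upper_bound_lt _ B delta = upper_bound_lt (cdf Y1) Y0 delta)//.
    by congr (1 + ereal_inf _)%E; apply: eq_imagel => y _ /=; rewrite BY0.
Qed.
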